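(* Let $G$ be a connected graph with $|V(G)|=m$, let $x,y$ be two distinct vertices of $G$, let $n\ge 3$, and let $F_n(G)=F_n(G,x,y)$ be the generalized flower graph. Let $Kf(\cdot)$ denote the Kirchhoff index. Then $$n\,Kf(G)-\frac{m(m-1)\,r_G(x,y)}{2}\ \le\ Kf(F_n(G))\ \le\ Kf(G)\,\bigl(n+nm(n-1)\bigr)+\frac{r_G(x,y)\,(n^3-n^2)\,m^2}{4}.$$
   Context: For a connected graph $H$ with vertex set $\{1,\dots,N\}$ and Laplacian matrix $L$, the resistance distance between vertices $i,j$ is $r_H(i,j)=(e_i-e_j)^T L^\dagger (e_i-e_j)$, where $e_i$ is the $i$th standard unit vector and $L^\dagger$ is the Moore–Penrose pseudoinverse of $L$. The Kirchhoff index is $Kf(H)=\frac12\sum_{i,j\in V(H)} r_H(i,j)$ (sum over ordered pairs). Generalized flower graph: let $G$ be a graph, $x\ne y$ two vertices of $G$, and $n\ge 3$. $F_n(G,x,y)$ (written $F_n(G)$) is the graph obtained by taking $n$ vertex-disjoint copies $G_1,\dots,G_n$ of $G$ (the petals), with $x_i,y_i$ the copies of $x,y$ in $G_i$, and identifying $y_i$ with $x_{i+1}$ for $1\le i<n$ and $y_n$ with $x_1$. *)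

(* Defs.v *)
From HB Require Import structures.
From mathcomp Require Import all_boot all_order all_algebra.
From mathcomp Require Import generic_quotient zify.

Set Implicit Arguments.
Unset Strict Implicit.
Unset Printing Implicit Defensive.

Import Order.TTheory GRing.Theory Num.Theory.

Section MoorePenrose.
Local Open Scope ring_scope.
Variable R : realFieldType.

Definition is_mp_inverse m n (A : 'M[R]_(m, n)) (X : 'M[R]_(n, m)) : Prop :=
  [/\ A *m X *m A = A, X *m A *m X = X,
      (A *m X)^T = A *m X & (X *m A)^T = X *m A].

(* If A = C *m B is a full-rank factorization (C of full column rank, B of
   full row rank), the Moore-Penrose inverse of A is
   B^T (B B^T)^-1 (C^T C)^-1 C^T.  (MathComp's pinvmx is another generalized
   inverse and does not satisfy the Penrose equations.) *)
Definition mp_inverse m n (A : 'M[R]_(m, n)) : 'M[R]_(n, m) :=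
  let B := row_base A in let C := col_base A in
  B^T *m invmx (B *m B^T) *m (invmx (C^T *m C) *m C^T).

Lemma gram_unitmx r n (B : 'M[R]_(r, n)) :
  row_free B -> B *m B^T \in unitmx.
Proof.
move=> freeB; rewrite -row_free_unit -kermx_eq0.
apply/eqP/row_matrixP=> i; rewrite row0.
set u := row i _.
have uBB : u *m (B *m B^T) = 0.
  by apply/sub_kermxP; rewrite /u row_sub.
have : (u *m B) *m (u *m B)^T = 0.
  by rewrite trmx_mul -mulmxA (mulmxA B) mulmxA uBB mul0mx.
move/matrixP/(_ 0 0); rewrite !mxE => /eqP.
rewrite psumr_eq0 => [|j _]; last by rewrite [X in _ * X]mxE -expr2 sqr_ge0.
move=> /allP uB0; have uB : u *m B = 0.
  apply/matrixP=> k j; rewrite ord1 [RHS]mxE.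
  have := uB0 j (mem_index_enum j).
  by rewrite /= [X in _ * X]mxE mulf_eq0 orbb => /eqP.
by apply: (row_free_inj freeB); rewrite uB mul0mx.
Qed.

Lemma full_rank_mp_inverse m n r (C : 'M[R]_(m, r)) (B : 'M[R]_(r, n)) :
  row_free B -> row_full C ->
  is_mp_inverse (C *m B)
    (B^T *m invmx (B *m B^T) *m (invmx (C^T *m C) *m C^T)).
Proof.
move=> freeB fullC; set X := (X in is_mp_inverse _ X).
have uB : B *m B^T \in unitmx by exact: gram_unitmx.
have uC : C^T *m C \in unitmx.
  rewrite -{2}[C]trmxK; apply: gram_unitmx.
  by rewrite /row_free mxrank_tr.
have AX : C *m B *m X = C *m (invmx (C^T *m C) *m C^T).
  by rewrite /X -!mulmxA (mulmxA B) (mulmxA (B *m B^T)) mulmxV // mul1mx.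
have XA : X *m (C *m B) = B^T *m (invmx (B *m B^T) *m B).
  by rewrite /X -!mulmxA (mulmxA C^T) (mulmxA _ (C^T *m C)) mulVmx // mul1mx.
split.
- by rewrite AX -!mulmxA (mulmxA C^T) (mulmxA _ (C^T *m C)) mulVmx // mul1mx.
- by rewrite XA /X -!mulmxA (mulmxA B) (mulmxA (B *m B^T)) mulmxV // mul1mx.
- by rewrite AX !trmx_mul trmxK trmx_inv trmx_mul trmxK mulmxA.
- by rewrite XA !trmx_mul trmxK trmx_inv trmx_mul trmxK mulmxA.
Qed.

Lemma mp_inverseP m n (A : 'M[R]_(m, n)) : is_mp_inverse A (mp_inverse A).
Proof.
have := full_rank_mp_inverse (row_base_free A) (col_base_full A).
by rewrite mulmx_base.
Qed.

Lemma mp_inverse_unique m n (A : 'M[R]_(m, n)) (X Y : 'M[R]_(n, m)) :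
  is_mp_inverse A X -> is_mp_inverse A Y -> X = Y.
Proof.
move=> [AXA XAX tAX tXA] [AYA YAY tAY tYA].
have AXY : A *m X = A *m Y.
  by rewrite -tAX -{1}AYA -(mulmxA (A *m Y)) trmx_mul tAX tAY mulmxA AXA.
have XYA : X *m A = Y *m A.
  by rewrite -tXA -{1}AYA -!mulmxA mulmxA trmx_mul tXA tYA -mulmxA
             (mulmxA A) AXA.
by rewrite -XAX XYA -mulmxA AXY mulmxA YAY.
Qed.

End MoorePenrose.

(* A finite simple graph is a symmetric irreflexive relation e on a finType T;
   its Laplacian is indexed by the enumeration of T. *)
Section Kirchhoff.
Local Open Scope ring_scope.
Variables (R : realFieldType) (T : finType).
Implicit Types (e : rel T) (u v : T).

Definition laplacian e : 'M[R]_#|T| :=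
  \matrix_(i, j) if i == j then #|[pred v | e (enum_val i) v]|%:R
                 else - (e (enum_val i) (enum_val j))%:R.

Definition std_vec u : 'cV[R]_#|T| := delta_mx (enum_rank u) 0.

Definition resistance e u v : R :=
  ((std_vec u - std_vec v)^T *m mp_inverse (laplacian e)
     *m (std_vec u - std_vec v)) 0 0.

Definition kirchhoff_index e : R :=
  2^-1 * \sum_(u : T) \sum_(v : T) resistance e u v.

End Kirchhoff.

Section Flower.
Variables (n : nat) (T : finType) (x y : T).
Implicit Types (p q : 'I_n * T) (i j : 'I_n) (e : rel T).

(* The pair (i, u) is the copy of the vertex u in the i-th petal. *)
Definition petal_step : rel ('I_n * T) :=
  fun p q => [&& p.2 == y, q.2 == x & q.1 == ordS p.1].

Definition petal_glue : rel ('I_n * T) :=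
  connect (fun p q => petal_step p q || petal_step q p).

Lemma petal_glue_sym : symmetric petal_glue.
Proof. by apply: sym_connect_sym => p q; rewrite orbC. Qed.

Definition petal_glue_equiv : equiv_rel ('I_n * T) :=
  EquivRel petal_glue (@connect0 _ _) petal_glue_sym (@connect_trans _ _).

Definition flower : Type := {eq_quot petal_glue_equiv}%qT.

HB.instance Definition _ := EqQuotient.on flower.
(* [Finite of _ by <:%/] is not usable here: its equality test differs from
   the one inherited from {eq_quot _}. *)
HB.instance Definition _ := Finite.copy flower
  (can_type (@EquivQuot.ereprK _ _ _ _ _ (defaultEncModRel petal_glue_equiv))).

Definition petal i (u : T) : flower := \pi_flower%qT (i, u).

Definition flower_adj e : rel flower := fun a b =>
  [exists i, exists u, exists v, [&& e u v, petal i u == a & petal i v == b]].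

Hypotheses (neq_xy : x != y) (n_ge3 : 2 < n).

Lemma val_ordS i : val (ordS i) = if i.+1 == n then 0 else i.+1.
Proof.
rewrite /=; case: eqP => [-> | /eqP]; first exact: modnn.
by move=> ?; rewrite modn_small //; have := ltn_ord i; lia.
Qed.

Lemma ordS_neq i : ordS i <> i.
Proof. by move/(congr1 val); rewrite val_ordS; case: eqP => /=; lia. Qed.

Lemma ordSS_neq i : ordS (ordS i) <> i.
Proof.
by move/(congr1 val); rewrite val_ordS val_ordS; do 2!case: eqP => //=; lia.
Qed.

(* Only the prescribed identifications are made. *)
Lemma petal_eqP i j u v :
  reflect [\/ (i, u) = (j, v), [/\ u = y, v = x & j = ordS i]
             | [/\ v = y, u = x & i = ordS j]]
          (petal i u == petal j v).
Proof.
pose E p q := [|| p == q, petal_step p q | petal_step q p].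
have nyx : (y == x) = false by rewrite eq_sym (negPf neq_xy).
have E_trans : transitive E.
  move=> [k w] [i1 u1] [j1 v1]; rewrite /E /petal_step /= => /or3P[].
  - by move/eqP=> [-> ->].
  - case/and3P=> /eqP -> /eqP -> /eqP -> /or3P[].
    + by move/eqP=> [<- <-]; rewrite !eqxx orbT.
    + by case/and3P; rewrite (negPf neq_xy).
    + case/and3P=> /eqP -> _ /eqP /ordS_inj ->.
      by rewrite eqxx.
  - case/and3P=> /eqP -> /eqP -> /eqP -> /or3P[].
    + by move/eqP=> [<- <-]; rewrite !eqxx !orbT.
    + by case/and3P=> _ /eqP -> /eqP ->; rewrite eqxx.
    + by case/and3P=> _; rewrite nyx.
have petalE : (petal i u == petal j v) = E (i, u) (j, v).
  rewrite /petal eqmodE /= /petal_glue; apply/idP/idP => [/connectP[s]|].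
    move=> es ->; elim: s (i, u) es => [p _|q s IHs p /=].
      by rewrite /E eqxx.
    case/andP=> pq /IHs; apply: E_trans.
    by rewrite /E pq orbT.
  by case/predU1P=> [-> | h]; [exact: connect0 | exact: connect1].
rewrite petalE; apply: (iffP or3P) => -[].
- by move/eqP; constructor 1.
- by case/and3P=> /= /eqP -> /eqP -> /eqP ->; constructor 2.
- by case/and3P=> /= /eqP -> /eqP -> /eqP ->; constructor 3.
- by move=> ->; constructor 1.
- by case=> -> -> ->; constructor 2; rewrite /petal_step /= !eqxx.
- by case=> -> -> ->; constructor 3; rewrite /petal_step /= !eqxx.
Qed.

Lemma flower_adj_sym e : symmetric e -> symmetric (flower_adj e).
Proof.
move=> e_sym; suff imp a b : flower_adj e a b -> flower_adj e b a.
  by move=> a b; apply/idP/idP; apply: imp.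
case/existsP=> i /existsP[u /existsP[v /and3P[euv ua vb]]].
apply/existsP; exists i; apply/existsP; exists v; apply/existsP; exists u.
by rewrite e_sym euv ua vb.
Qed.

Lemma flower_adj_irr e : irreflexive e -> irreflexive (flower_adj e).
Proof.
move=> e_irr a; apply/negbTE/negP => /existsP[i /existsP[u /existsP[v]]].
case/and3P=> euv /eqP <- /petal_eqP[[]|[_ _ /esym/ordS_neq]|[_ _ /esym/ordS_neq]] //.
by move=> vu; rewrite vu e_irr in euv.
Qed.

(* Distinct edges of the petals stay distinct after the identification, so
   the relation flower_adj e does not merge parallel edges. *)
Lemma flower_edge_inj e i j u v u' v' :
  irreflexive e -> e u v -> e u' v' ->
  petal i u = petal j u' -> petal i v = petal j v' ->
  [/\ i = j, u = u' & v = v'].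
Proof.
move=> e_irr euv euv' /eqP/petal_eqP uu' /eqP/petal_eqP vv'.
have nuv : u <> v by move=> E; rewrite E e_irr in euv.
have nuv' : u' <> v' by move=> E; rewrite E e_irr in euv'.
case: uu' => [[ij uu']|[uy _ ji]|[_ ux ij]].
- case: vv' => [[_ vv']//|[_ _ ji]|[_ _ ji]]; case: (@ordS_neq i); congruence.
- case: vv' => [[ij _]|[vy _ _]|[_ _ ij]].
  + by case: (@ordS_neq i); congruence.
  + by case: nuv; congruence.
  + by case: (@ordSS_neq i); congruence.
- case: vv' => [[ji _]|[_ _ ji]|[_ vx _]].
  + by case: (@ordS_neq j); congruence.
  + by case: (@ordSS_neq j); congruence.
  + by case: nuv; congruence.
Qed.

Lemma flower_connected e :
  (forall u v, connect e u v) -> forall a b, connect (flower_adj e) a b.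
Proof.
move=> e_conn.
have in_petal i u v : connect (flower_adj e) (petal i u) (petal i v).
  have /connectP[s es ->] := e_conn u v.
  elim: s u es => [|w s IHs] u /=; first by rewrite connect0.
  case/andP=> euw /IHs; apply: connect_trans; apply: connect1.
  apply/existsP; exists i; apply/existsP; exists u; apply/existsP; exists w.
  by rewrite euw !eqxx.
have step i : petal i y = petal (ordS i) x.
  by apply/eqP/petal_eqP; constructor 2.
have iter_ordS i k u v :
    connect (flower_adj e) (petal i u) (petal (iter k (@ordS n) i) v).
  elim: k v => [|k IHk] v /=; first exact: in_petal.
  by apply: connect_trans (IHk y) _; rewrite step.
have iter_val i k : i + k < n -> val (iter k (@ordS n) i) = i + k.
  elim: k => [|k IHk] ikn; first by rewrite addn0.
  by rewrite iterS val_ordS IHk; first case: eqP => //; lia.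
have reach i j u v : i <= j -> connect (flower_adj e) (petal i u) (petal j v).
  move=> ij; suff -> : j = iter (j - i) (@ordS n) i by [].
  by apply: val_inj; rewrite iter_val subnKC.
have ordS_max i : i.+1 = n -> val (ordS i) = 0.
  by move=> Ei; rewrite val_ordS Ei eqxx.
have last_i (i : 'I_n) : {l : 'I_n | l.+1 = n}.
  have ltn1n : n.-1 < n by lia.
  by exists (Ordinal ltn1n) => /=; lia.
move=> a b; rewrite -[a]reprK -[b]reprK.
case: (repr a) (repr b) => i u [j v].
have [l El] := last_i i.
apply: (connect_trans (reach i l u y _)); first by have := ltn_ord i; lia.
rewrite step; apply: (reach _ j x v).
by have := ordS_max l El; rewrite /= => ->.
Qed.

End Flower.

(* Main.v *)
(* Effective resistances obey Dirichlet's principle: r(u,v) is the maximum over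
   g of 2 (g(u) - g(v)) - E(g), where E is the energy form of the Laplacian,
   and the maximum is attained at the potential f with L f = e_u - e_v.  The
   energy of a function on the flower is the sum of the energies of its
   restrictions to the petals.  Restricting the optimal potential to a petal
   gives r_F <= r_G inside a petal; extending the potential of G to a test
   function on the flower gives r_F >= r_G - r_G(x,y)/n there, and summing over
   the n m (m-1) / 2 pairs lying in a common petal yields the lower bound.  For
   the upper bound, a vertex of one petal is joined to a vertex of another one
   by the triangle inequality through the copies of x in both petals, which are
   at most n/2 petals, hence resistance n r_G(x,y) / 2, apart. *)
Require Import Defs.
From mathcomp Require Import all_boot all_order all_algebra.
From mathcomp Require Import generic_quotient zify ring lra.

Import Order.TTheory GRing.Theory Num.Theory.
Local Open Scope ring_scope.

(** * Energy form, potentials and effective resistance of a finite graph *)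

Section Resistance.
Set Implicit Arguments.
Unset Strict Implicit.
Variables (R : realFieldType) (T : finType) (e : rel T).
Implicit Types (u v w : T) (f g h : T -> R).

(** The half compensates for each edge occurring in both orientations. *)
Definition dirichlet f g : R :=
  2^-1 * \sum_u \sum_(v | e u v) (f u - f v) * (g u - g v).

(** Weak form of [L f = e_u - e_v], free of matrices and of the enumeration of [T]. *)
Definition potential u v f := forall g, dirichlet g f = g u - g v.

Lemma dirichletC f g : dirichlet f g = dirichlet g f.
Proof. by congr (_ * _); do 2!apply: eq_bigr => ? _; rewrite mulrC. Qed.

Lemma eq_dirichlet f f' g g' :
  f =1 f' -> g =1 g' -> dirichlet f g = dirichlet f' g'.
Proof.
by move=> Ef Eg; congr (_ * _); do 2!apply: eq_bigr => ? _; rewrite !Ef !Eg.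
Qed.

Lemma dirichlet_affine g f h a b c :
  dirichlet g (fun w => a * f w + b * h w + c)
  = a * dirichlet g f + b * dirichlet g h.
Proof.
rewrite /dirichlet !(mulrCA _ 2^-1) -mulrDr; congr (_ * _).
rewrite !mulr_sumr -big_split; apply: eq_bigr => u _.
rewrite !mulr_sumr -big_split; apply: eq_bigr => v _ /=; ring.
Qed.

Lemma dirichlet_square f h a b c :
  let k w := a * f w + b * h w + c in
  dirichlet k k = a ^+ 2 * dirichlet f f + 2 * a * b * dirichlet f h
                  + b ^+ 2 * dirichlet h h.
Proof.
rewrite /= dirichlet_affine (dirichletC _ f) (dirichletC _ h).
by rewrite !dirichlet_affine (dirichletC h f); ring.
Qed.

Lemma dirichlet_ge0 f : 0 <= dirichlet f f.
Proof.
apply: mulr_ge0; first by rewrite invr_ge0.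
by do 2!apply: sumr_ge0 => ? _; rewrite -expr2 sqr_ge0.
Qed.

Hypothesis e_conn : forall u v, connect e u v.

Lemma dirichlet_eq0 f u v : dirichlet f f = 0 -> f u = f v.
Proof.
move/eqP; rewrite mulf_eq0 invr_eq0 pnatr_eq0 /= => /eqP D0.
have sq0 a b : 0 <= (f a - f b) * (f a - f b) by rewrite -expr2 sqr_ge0.
have edge a b : e a b -> f a = f b.
  move=> eab; apply/eqP; rewrite -subr_eq0 -[_ == 0]orbb -mulf_eq0; apply/eqP.
  apply: (@psumr_eq0P _ _ (e a) (fun c => (f a - f c) * (f a - f c)) _ _ b) => //.
  by apply: (psumr_eq0P _ D0) => // c _; apply: sumr_ge0.
have /connectP[s es ->] := e_conn u v.
by elim: s u es => //= w s IHs u /andP[/edge ->] /IHs.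
Qed.

(* The positive part of [h - h u] has nonpositive energy, hence vanishes. *)
Lemma potential_le u v h : potential u v h -> forall w, h w <= h u.
Proof.
move=> ph w; pose d w := Num.max 0 (h w - h u).
have d_ge0 z : 0 <= d z by rewrite /d le_max lexx.
have du : d u = 0 by rewrite /d subrr maxxx.
(* On each edge, truncation gives [(d a - d b)^2 <= (d a - d b) (h a - h b)]. *)
have Ed : dirichlet d d <= dirichlet d h.
  rewrite ler_pM2l ?invr_gt0 //; do 2!apply: ler_sum => ? _; rewrite /d.
  by do 2!case: (lerP 0 (h _ - h u)) => ?; nra.
have := dirichlet_ge0 d; rewrite (ph d) in Ed => d0.
have Dd : dirichlet d d = 0.
  by have := d_ge0 v; move: Ed; rewrite du; lra.
have := dirichlet_eq0 w u Dd; rewrite du /d.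
by case: (lerP 0 (h w - h u)); lra.
Qed.

Lemma potentialN u v h : potential u v h -> potential v u (fun w => - h w).
Proof.
move=> ph g.
rewrite (@eq_dirichlet g g _ (fun w => -1 * h w + 0 * h w + 0)) //; last first.
  by move=> w; ring.
by rewrite dirichlet_affine ph; ring.
Qed.

Lemma potential_ge u v h : potential u v h -> forall w, h v <= h w.
Proof. by move/potentialN/potential_le => hN w; have := hN w; lra. Qed.

(** * The Laplacian matrix and its pseudoinverse *)

Hypotheses (e_sym : symmetric e) (e_irr : irreflexive e).

Definition vec_fun (f : T -> R) : 'cV[R]_#|T| := \col_i f (enum_val i).
Definition fun_vec (c : 'cV[R]_#|T|) : T -> R := fun w => c (enum_rank w) 0.

Lemma sum_enum_val (F : T -> R) : \sum_(i < #|T|) F (enum_val i) = \sum_w F w.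
Proof.
rewrite (reindex enum_rank) /=; last by apply: onW_bij; exact: enum_rank_bij.
by apply: eq_bigr => w _; rewrite enum_rankK.
Qed.

Lemma laplacian_mul c i :
  (laplacian R e *m c) i 0
  = \sum_(w | e (enum_val i) w) (fun_vec c (enum_val i) - fun_vec c w).
Proof.
rewrite sumrB sumr_const mxE.
(* Degree matrix minus adjacency matrix; at [j = i] the adjacency term vanishes by irreflexivity. *)
transitivity (\sum_j ((j == i)%:R * (#|[pred v | e (enum_val i) v]|%:R * c j 0)
    - (e (enum_val i) (enum_val j))%:R * fun_vec c (enum_val j))).
  apply: eq_bigr => j _; rewrite mxE /fun_vec enum_valK eq_sym.
  case: eqP => [->|_]; first by rewrite e_irr /=; ring.
  by rewrite mul0r sub0r mulNr.
rewrite sumrB; congr (_ - _).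
  rewrite (bigD1 i) //= eqxx big1 => [|j /negPf ->]; last by rewrite mul0r.
  by rewrite addr0 mul1r /fun_vec enum_valK mulr_natl.
rewrite (sum_enum_val (fun w => (e (enum_val i) w)%:R * fun_vec c w)).
by rewrite [RHS]big_mkcond; apply: eq_bigr => w _; case: ifP; rewrite ?mul1r ?mul0r.
Qed.

Lemma trmx_laplacian : (laplacian R e)^T = laplacian R e.
Proof.
by apply/matrixP=> i j; rewrite !mxE eq_sym e_sym; case: eqP => [->|].
Qed.

(** Summation by parts: exchanging the endpoints of edges shows that both terms of [g u - g w]
    contribute the same sum. *)
Lemma dirichlet_laplacian g c :
  dirichlet g (fun_vec c) = \sum_i g (enum_val i) * (laplacian R e *m c) i 0.
Proof.
under eq_bigr do rewrite laplacian_mul.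
rewrite (sum_enum_val (fun u => g u * \sum_(w | e u w) (fun_vec c u - fun_vec c w))).
rewrite /dirichlet; set f := fun_vec c; set S := RHS.
have ES : \sum_u \sum_(w | e u w) g u * (f u - f w) = S.
  by apply: eq_bigr => u _; rewrite mulr_sumr.
have ES' : \sum_u \sum_(w | e u w) g w * (f w - f u) = S.
  rewrite -ES (exchange_big_dep predT) //=; apply: eq_bigr => u _.
  by apply: eq_bigl => w; rewrite e_sym.
suff -> : \sum_u \sum_(w | e u w) (g u - g w) * (f u - f w) = S + S by lra.
rewrite -{1}ES -ES' -big_split; apply: eq_bigr => u _.
by rewrite -big_split; apply: eq_bigr => w _ /=; ring.
Qed.

Lemma std_vecE u i : std_vec R u i 0 = (enum_val i == u)%:R.
Proof. by rewrite mxE andbT -(inj_eq enum_val_inj) enum_rankK. Qed.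

Lemma sum_std_vec (g : T -> R) u v :
  \sum_i g (enum_val i) * (std_vec R u - std_vec R v) i 0 = g u - g v.
Proof.
have E i : (std_vec R u - std_vec R v) i 0
           = (enum_val i == u)%:R - (enum_val i == v)%:R.
  by rewrite -!std_vecE !mxE.
have one w : \sum_(i < #|T|) g (enum_val i) * (enum_val i == w)%:R = g w.
  rewrite (sum_enum_val (fun z => g z * (z == w)%:R)).
  rewrite (bigD1 w) //= eqxx mulr1 big1 ?addr0 // => z /negPf ->.
  by rewrite mulr0.
by under eq_bigr do rewrite E mulrBr; rewrite sumrB !one.
Qed.

(** The residual [w = p - L X p] lies in the kernel of [L], so connectivity makes it constant; its
    entries sum to zero, so it vanishes. *)
Lemma laplacian_mp_inverse u v :
  let p := std_vec R u - std_vec R v in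
  laplacian R e *m (mp_inverse (laplacian R e) *m p) = p.
Proof.
move=> p; set L := laplacian R e.
have [] := mp_inverseP L; move: (mp_inverse L) => X LXL _ LXs _.
(* Transpose [L X L = L], both [L] and [L X] being symmetric. *)
have LP : L *m (L *m X) = L.
  by rewrite -[RHS]trmx_laplacian -/L -{3}LXL trmx_mul LXs trmx_laplacian.
pose w := p - L *m (X *m p).
have Lw : L *m w = 0.
  by rewrite mulmxBr !mulmxA -(mulmxA L L X) LP subrr.
have w_const a b : fun_vec w a = fun_vec w b.
  apply: dirichlet_eq0; rewrite dirichlet_laplacian -/L Lw big1 // => i _.
  by rewrite mxE mulr0.
(* Both [p] and the range of [L] are orthogonal to the constants. *)
have sum_w : \sum_i w i 0 = 0.
  rewrite (eq_bigr (fun i => 1 * p i 0 - 1 * (L *m (X *m p)) i 0)); last first.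
    by move=> i _; rewrite !mul1r !mxE.
  rewrite sumrB (sum_std_vec (fun=> 1)) -(dirichlet_laplacian (fun=> 1)).
  rewrite /dirichlet big1 => [|a _]; first by rewrite mulr0 /= !subrr.
  by rewrite big1 // => b _; rewrite subrr mul0r.
suff w0 : w = 0 by apply/esym/eqP; rewrite -subr_eq0 -/w w0.
apply/matrixP=> i j; rewrite ord1 [RHS]mxE.
have wE k : w k 0 = w i 0.
  by have := w_const (enum_val k) (enum_val i); rewrite /fun_vec !enum_valK.
move: sum_w; rewrite (eq_bigr (fun=> w i 0)) // sumr_const card_ord.
move/eqP; rewrite mulrn_eq0 => /orP[/eqP T0|/eqP //].
by have := ltn_ord i; rewrite {2}T0.
Qed.

(** * Resistance as a potential drop *)

Lemma potential_exists u v : {f | potential u v f & resistance R e u v = f u - f v}.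
Proof.
pose p := std_vec R u - std_vec R v.
pose c := mp_inverse (laplacian R e) *m p.
exists (fun_vec c) => [g|].
  by rewrite dirichlet_laplacian laplacian_mp_inverse sum_std_vec.
rewrite /resistance -mulmxA -/p -/c mxE -sum_std_vec.
by apply: eq_bigr => i _; rewrite mxE mulrC /fun_vec enum_valK.
Qed.

(** Any potential computes the resistance: two of them have equal drops because the form is
    symmetric. *)
Lemma resistance_potential u v f : potential u v f -> resistance R e u v = f u - f v.
Proof.
by move=> pf; have [h ph ->] := potential_exists u v; rewrite -pf dirichletC ph.
Qed.

Lemma resistance_ge0 u v : 0 <= resistance R e u v.
Proof. by have [f pf ->] := potential_exists u v; rewrite -pf dirichlet_ge0. Qed.

Lemma resistancexx u : resistance R e u u = 0.
Proof. by have [f _ ->] := potential_exists u u; rewrite subrr. Qed.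

Lemma resistanceC u v : resistance R e u v = resistance R e v u.
Proof.
have [f pf ->] := potential_exists u v.
by rewrite (resistance_potential (potentialN pf)); ring.
Qed.

(** Expand the nonnegative energy of [g - f], where [f] is a potential of [(u, v)]. *)
Lemma resistance_variational u v g :
  2 * (g u - g v) - dirichlet g g <= resistance R e u v.
Proof.
have [f pf ->] := potential_exists u v.
have := dirichlet_ge0 (fun w => 1 * g w + -1 * f w + 0).
by rewrite dirichlet_square !pf; lra.
Qed.

(** Superposition: potentials [f] of [(u, v)] and [h] of [(v, w)] add up to one of [(u, w)], and
    extremality at the poles gives [f v <= f w] and [h u <= h v]. *)
Lemma resistance_triangle v u w :
  resistance R e u w <= resistance R e u v + resistance R e v w.
Proof.
have [f pf ->] := potential_exists u v.
have [h ph ->] := potential_exists v w.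
have pfh : potential u w (fun z => 1 * f z + 1 * h z + 0).
  by move=> g; rewrite dirichlet_affine pf ph; ring.
rewrite (resistance_potential pfh).
have := potential_ge pf w; have := potential_le ph u; lra.
Qed.

End Resistance.

(** * Comparing sums of nonnegative terms along a map *)

Section BigSums.
Set Implicit Arguments.
Unset Strict Implicit.
Variables (R : realFieldType) (A B : finType) (f : A -> B) (F : B -> R).
Hypothesis F_ge0 : forall b, 0 <= F b.

Lemma ler_sum_surj : (forall b, exists a, f a = b) -> \sum_b F b <= \sum_a F (f a).
Proof.
move=> f_surj; rewrite (partition_big f predT) //=; apply: ler_sum => b _.
have [a fa] := f_surj b; rewrite (bigD1 a) /=; last by rewrite fa.
by rewrite fa lerDl; apply: sumr_ge0.
Qed.

Lemma ler_sum_inj (P : pred A) :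
  {in P &, injective f} -> \sum_(a | P a) F (f a) <= \sum_b F b.
Proof.
move=> f_inj; rewrite -(big_imset F (h := f) (A := P)) //=.
by rewrite [leRHS](bigID (mem (f @: P))) /= lerDl; apply: sumr_ge0.
Qed.

End BigSums.

Lemma kirchhoff_index_pair (R : realFieldType) (V : finType) (a : rel V) :
  kirchhoff_index R a = 2^-1 * \sum_(p : V * V) resistance R a p.1 p.2.
Proof. by rewrite /kirchhoff_index pair_big. Qed.

(** * Energy and resistances in the flower *)

Section FlowerResistance.
Set Implicit Arguments.
Unset Strict Implicit.
Variables (R : realFieldType) (n : nat) (T : finType) (x y : T) (e : rel T).
Hypotheses (e_sym : symmetric e) (e_irr : irreflexive e).
Hypotheses (e_conn : forall u v, connect e u v).
Hypotheses (neq_xy : x != y) (n_ge3 : (2 < n)%N).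
Implicit Types (i j : 'I_n) (u v w : T).

Local Notation FT := (flower n x y).
Local Notation "'pet'" := (@petal n T x y) (at level 0).
Local Notation FA := (@flower_adj n T x y e).
Local Notation r := (resistance R e x y).
Local Notation rF := (resistance R FA).

Let F_sym : symmetric FA := flower_adj_sym e_sym.
Let F_irr : irreflexive FA := flower_adj_irr neq_xy n_ge3 e_irr.
Let F_conn : forall a b, connect FA a b := flower_connected neq_xy n_ge3 e_conn.

Lemma petal_repr (a : FT) : pet (repr a).1 (repr a).2 = a.
Proof. by rewrite -[RHS]reprK; case: (repr a). Qed.

(** By [flower_edge_inj], oriented edges of the flower correspond bijectively to pairs of a petal
    and an oriented edge of [e]. *)
Lemma dirichlet_flower (f g : FT -> R) :
  dirichlet FA f g = \sum_i dirichlet e (f \o pet i) (g \o pet i).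
Proof.
rewrite /dirichlet -mulr_sumr; congr (_ * _).
pose phi (p : FT * FT) := (f p.1 - f p.2) * (g p.1 - g p.2).
pose E := [set q : 'I_n * (T * T) | e q.2.1 q.2.2].
pose pp (q : 'I_n * (T * T)) := (pet q.1 q.2.1, pet q.1 q.2.2).
have pp_inj : {in E &, injective pp}.
  move=> [i [u v]] [j [u' v']]; rewrite !inE /= => euv euv' [Eu Ev].
  by have [-> -> ->] := flower_edge_inj neq_xy n_ge3 e_irr euv euv' Eu Ev.
rewrite (pair_big_dep predT FA (fun a b => phi (a, b))) /=.
rewrite (eq_bigl (mem (pp @: E))) => [|[a b] /=]; last first.
  apply/idP/imsetP => [/existsP[i /existsP[u /existsP[v /and3P[euv]]]]|].
    by move=> /eqP <- /eqP <-; exists (i, (u, v)); rewrite ?inE.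
  case=> -[i [u v]]; rewrite inE /= => euv [-> ->].
  apply/existsP; exists i; apply/existsP; exists u; apply/existsP; exists v.
  by rewrite euv !eqxx.
rewrite (eq_bigr phi) => [|[]//]; rewrite big_imset //=.
under [RHS]eq_bigr do
  rewrite (pair_big_dep predT e (fun u v => phi (pp (_, (u, v))))) /=.
rewrite (pair_big_dep predT (fun _ q => e q.1 q.2)
          (fun i q => phi (pp (i, q)))) /=.
by apply: eq_big => [[i [u v]]|[i [u v]]]; rewrite ?inE.
Qed.

Lemma resistance_petal_le i u v : rF (pet i u) (pet i v) <= resistance R e u v.
Proof.
have [f pf ->] := potential_exists R F_conn F_sym F_irr (pet i u) (pet i v).
have := resistance_variational e_conn e_sym e_irr u v (f \o pet i).
apply: le_trans; rewrite /= -(pf f) dirichlet_flower (bigD1 i) //=.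
have : 0 <= \sum_(j < n | j != i) dirichlet e (f \o pet j) (f \o pet j).
  by apply: sumr_ge0 => j _; apply: dirichlet_ge0.
have : dirichlet FA f f = f (pet i u) - f (pet i v) by exact: pf.
rewrite dirichlet_flower (bigD1 i) //=; lra.
Qed.

(* Test function: the potential of (u, v) on the i-th petal, corrected on every
   petal by a multiple of the potential of (x, y) so that it closes up. *)
Lemma resistance_petal_ge i u v :
  resistance R e u v - r / n%:R <= rF (pet i u) (pet i v).
Proof.
have [f pf Ef] := potential_exists R e_conn e_sym e_irr u v.
have [h ph Eh] := potential_exists R e_conn e_sym e_irr x y.
pose b := f x - f y.
have n_gt0 : 0 < n%:R :> R by rewrite ltr0n; lia.
have bE : b = h u - h v by rewrite -pf dirichletC ph.
(* The values of [h] lie between [h y] and [h x], so [b] lies between [-r] and [r]; the factor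
   [beta] also covers [r = 0]. *)
have [beta br beta1] : exists2 beta, b = beta * r & beta ^+ 2 <= 1.
  have r0 := resistance_ge0 R e_conn e_sym e_irr x y.
  have b_le : b <= r.
    have := potential_le e_conn ph u; have := potential_ge e_conn ph v.
    by rewrite bE Eh; lra.
  have b_ge : - r <= b.
    have := potential_le e_conn ph v; have := potential_ge e_conn ph u.
    by rewrite bE Eh; lra.
  have [r00|rn0] := eqVneq r 0.
    by exists 0; [move: b_le b_ge; rewrite r00; lra | rewrite expr0n ler01].
  have r_gt0 : 0 < r by rewrite lt_def rn0.
  exists (b / r); first by rewrite divfK.
  have : b / r <= 1 by rewrite ler_pdivrMr // mul1r.
  have : -1 <= b / r by rewrite ler_pdivlMr // mulN1r.
  nra.
(* Chosen so that [s r = - b / n]: the corrections on the [n] petals together cancel the drop [b] of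
   [f]. *)
pose s := - beta / n%:R.
(* The offset makes [g j x] equal to [j b / n], minus [b] once petal [i] has been passed. *)
pose c (j : 'I_n) := j%:R * (b / n%:R) - (i < j)%N%:R * b
                     - (j == i)%:R * f x - s * h x.
pose g j w := (j == i)%:R * f w + s * h w + c j.
have g_glue j : g j y = g (ordS j) x.
  have sr : s * r = - (b / n%:R) by rewrite br /s; field; rewrite lt0r_neq0.
  have -> : g j y = j%:R * (b / n%:R) - (i < j)%N%:R * b - (j == i)%:R * b
                    - s * r.
    by rewrite Eh /g /c /b; ring.
  have -> : g (ordS j) x = (ordS j)%:R * (b / n%:R) - (i < ordS j)%N%:R * b.
    by rewrite /g /c; ring.
  rewrite sr (val_ordS neq_xy n_ge3).
  have ij : (i <= j)%N%:R = (i < j)%N%:R + (j == i)%:R :> R.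
    rewrite leq_eqVlt eq_sym (inj_eq val_inj).
    by case: eqP => [->|_]; rewrite ?ltnn ?add0r ?addr0.
  (* Wrap-around: [ordS j] is 0, and the accumulated value [n (b / n) - b] is zero, so the cycle
     closes. *)
  have [jn|_] := eqVneq j.+1 n.
    have -> : (i < j)%N%:R = 1 - (j == i)%:R :> R.
      have ij_le : (i <= j)%N by have := ltn_ord i; lia.
      by move: ij; rewrite ij_le /=; lra.
    have <- : j%:R + 1 = n%:R :> R by rewrite natr1 jn.
    rewrite ltn0 !mulr0n.
    have : j%:R + 1 != 0 :> R by rewrite natr1 pnatr_eq0.
    by move=> j1; field.
  by rewrite ltnS ij -natr1; ring.
(* By [g_glue], the value does not depend on the chosen representative. *)
pose G (a : FT) := g (repr a).1 (repr a).2.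
have GE j w : G (pet j w) = g j w.
  have /eqP/(petal_eqP neq_xy) := petal_repr (pet j w).
  rewrite /G; case: (repr _) => k z /= [[-> ->] //|[-> -> ->]|[-> -> ->]].
    exact: g_glue.
  by rewrite g_glue.
have := resistance_variational F_conn F_sym F_irr (pet i u) (pet i v) G.
apply: le_trans; rewrite !GE dirichlet_flower.
have DG j : dirichlet e (G \o pet j) (G \o pet j)
    = (j == i)%:R ^+ 2 * (f u - f v) + 2 * (j == i)%:R * s * b + s ^+ 2 * r.
  rewrite (@eq_dirichlet _ _ _ _ (g j) _ (g j)); try by move=> w; exact: GE.
  by rewrite dirichlet_square pf !ph Eh.
rewrite (eq_bigr (fun j => (j == i)%:R * (f u - f v + 2 * s * b) + s ^+ 2 * r));
  last by move=> j _; rewrite DG; case: eqP => _ /=; ring.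
rewrite big_split /= sumr_const card_ord -[_ * r *+ n]mulr_natl (bigD1 i) //= eqxx.
rewrite big1 => [|j /negPf ->]; last by rewrite mul0r.
rewrite /g eqxx Ef.
(* The gain [2 s (h u - h v)] cancels the cross energy [2 s b], so the only loss is
   [beta^2 r / n]. *)
have -> : n%:R * (s ^+ 2 * r) = beta ^+ 2 * (r / n%:R).
  by rewrite /s; field; rewrite lt0r_neq0.
have rn0 : 0 <= r / n%:R by rewrite divr_ge0 ?ler0n // resistance_ge0.
have := ler_wpM2r rn0 beta1; rewrite bE /=; lra.
Qed.

Lemma iter_ordS i k : val (iter k (@ordS n) i) = ((i + k) %% n)%N.
Proof.
elim: k => [|k IHk]; first by rewrite addn0 modn_small.
by rewrite iterS /= IHk -addn1 modnDml addn1 addnS.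
Qed.

Lemma resistance_hub_iter i k :
  rF (pet i x) (pet (iter k (@ordS n) i) x) <= k%:R * r.
Proof.
elim: k => [|k IHk]; first by rewrite resistancexx // mul0r.
apply: le_trans (resistance_triangle R F_conn F_sym F_irr
  (pet (iter k (@ordS n) i) x) _ _) _.
rewrite -natr1 mulrDl mul1r; apply: lerD IHk _.
have /eqP <- : pet (iter k (@ordS n) i) y == pet (iter k.+1 (@ordS n) i) x.
  by apply/petal_eqP => //; constructor 2.
exact: resistance_petal_le.
Qed.

Lemma resistance_hub_le i j : rF (pet i x) (pet j x) <= n%:R / 2 * r.
Proof.
(* The two arcs between the hubs have [a] and [b] petals; averaging their bounds avoids choosing the
   shorter one. *)
have half a b (z : R) : (a + b)%N = n -> z <= a%:R * r -> z <= b%:R * r ->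
    z <= n%:R / 2 * r.
  by move=> <- za zb; rewrite natrD; lra.
wlog ij : i j / (i <= j)%N.
  by move=> IH; case/orP: (leq_total i j) => /IH //; rewrite resistanceC.
have Ej : iter (j - i) (@ordS n) i = j.
  by apply: val_inj; rewrite /= iter_ordS subnKC // modn_small.
have Ei : iter (n - (j - i)) (@ordS n) j = i.
  apply: val_inj; rewrite /= iter_ordS.
  have -> : (j + (n - (j - i)) = i + n)%N by have := ltn_ord j; lia.
  by rewrite modnDr modn_small.
apply: (half (j - i)%N (n - (j - i))%N); first by have := ltn_ord j; lia.
  by rewrite -{1}Ej resistance_hub_iter.
by rewrite (resistanceC _ F_conn) // -{1}Ei resistance_hub_iter.
Qed.

Lemma resistance_flower_le i j u v :
  rF (pet i u) (pet j v)
  <= resistance R e u x + n%:R / 2 * r + resistance R e x v.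
Proof.
apply: le_trans (resistance_triangle R F_conn F_sym F_irr (pet j x) _ _) _.
apply: lerD; last exact: resistance_petal_le.
apply: le_trans (resistance_triangle R F_conn F_sym F_irr (pet i x) _ _) _.
by apply: lerD; [exact: resistance_petal_le | exact: resistance_hub_le].
Qed.

(** * Bounds on the Kirchhoff index of the flower *)

Lemma kirchhoff_flower_ge :
  n%:R * kirchhoff_index R e - #|T|%:R * (#|T|%:R - 1) * r / 2
  <= kirchhoff_index R FA.
Proof.
have n_neq0 : n%:R != 0 :> R by rewrite pnatr_eq0; lia.
pose pp (q : 'I_n * (T * T)) := (pet q.1 q.2.1, pet q.1 q.2.2).
pose P := [pred q : 'I_n * (T * T) | q.2.1 != q.2.2].
have pp_inj : {in P &, injective pp}.
  move=> [i [u v]] [j [u' v']]; rewrite !inE /= => uv uv' [Eu Ev].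
  (* [flower_edge_inj] is applied to the complete graph on [T]: a pair of distinct flower vertices
     comes from at most one petal. *)
  have neq_irr : irreflexive (fun a b : T => a != b) by move=> a; rewrite eqxx.
  by have [-> -> ->] := flower_edge_inj neq_xy n_ge3 neq_irr uv uv' Eu Ev.
have rF_ge0 (p : FT * FT) : 0 <= rF p.1 p.2 by apply: resistance_ge0.
have := ler_sum_inj rF_ge0 pp_inj; rewrite (kirchhoff_index_pair _ FA) {1}/kirchhoff_index => Hle.
set K := \sum_u \sum_v resistance R e u v.
suff : n%:R * K - #|T|%:R * (#|T|%:R - 1) * r
       <= \sum_(q | P q) rF (pp q).1 (pp q).2 by lra.
rewrite -(pair_big_dep predT (fun _ q => q.1 != q.2)
            (fun i (q : T * T) => rF (pet i q.1) (pet i q.2))) /=.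
have Ei i : K - #|T|%:R * (#|T|%:R - 1) * (r / n%:R)
    <= \sum_(q : T * T | q.1 != q.2) rF (pet i q.1) (pet i q.2).
  rewrite -(pair_big_dep predT (fun u v => u != v)
              (fun u v => rF (pet i u) (pet i v))) /=.
  have -> : #|T|%:R * (#|T|%:R - 1) * (r / n%:R)
            = \sum_(u : T) (#|T|%:R - 1) * (r / n%:R).
    by rewrite sumr_const -[RHS]mulr_natl mulrA.
  rewrite -sumrB; apply: ler_sum => u _.
  rewrite (bigD1 u) //= resistancexx // add0r.
  rewrite (eq_bigl (fun v => u != v)) => [|v]; last by rewrite eq_sym.
  have -> : (#|T|%:R - 1) * (r / n%:R) = \sum_(v | u != v) (r / n%:R).
    rewrite sumr_const -[RHS]mulr_natl; congr (_ * _).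
    have := cardC1 u; rewrite (eq_card (B := fun v => u != v)) => [->|v].
      by rewrite -subn1 natrB //; apply/card_gt0P; exists u.
    by rewrite !inE eq_sym.
  rewrite -sumrB; apply: ler_sum => v _; exact: resistance_petal_ge.
apply: le_trans (ler_sum _ (fun i _ => Ei i)).
rewrite sumr_const card_ord -mulr_natl le_eqVlt; apply/orP; left.
by apply/eqP; field.
Qed.

(** Summing over petal coordinates counts glued vertices repeatedly, which only enlarges the sum.
    The [n] diagonal petal pairs and the [n (n - 1)] others are then bounded separately. *)
Lemma kirchhoff_flower_le :
  kirchhoff_index R FA
  <= kirchhoff_index R e * (n%:R + n%:R * #|T|%:R * (n%:R - 1))
     + r * (n%:R ^+ 3 - n%:R ^+ 2) * #|T|%:R ^+ 2 / 4.
Proof.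
set K := \sum_u \sum_v resistance R e u v.
set N := n%:R; set M := #|T|%:R.
pose pp (q : ('I_n * T) * ('I_n * T)) := (pet q.1.1 q.1.2, pet q.2.1 q.2.2).
have pp_surj p : exists q, pp q = p.
  by case: p => a b; exists (repr a, repr b); rewrite /pp /= !petal_repr.
have rF_ge0 (p : FT * FT) : 0 <= rF p.1 p.2 by apply: resistance_ge0.
have := ler_sum_surj rF_ge0 pp_surj; rewrite (kirchhoff_index_pair _ FA) /kirchhoff_index -/K => Hle.
suff : \sum_q rF (pp q).1 (pp q).2
    <= K * (N + N * M * (N - 1)) + r * (N ^+ 3 - N ^+ 2) * M ^+ 2 / 2 by lra.
rewrite -(pair_big predT predT (fun p q => rF (pet p.1 p.2) (pet q.1 q.2))) /=.
under eq_bigr do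
  rewrite -(pair_big predT predT (fun j v => rF (pet _ _) (pet j v))) /=.
rewrite -(pair_big predT predT
  (fun i u => \sum_j \sum_v rF (pet i u) (pet j v))) /=.
under eq_bigr do rewrite exchange_big /=.
have same i : \sum_u \sum_v rF (pet i u) (pet i v) <= K.
  by do 2!apply: ler_sum => ? _; apply: resistance_petal_le.
have other i j : \sum_u \sum_v rF (pet i u) (pet j v)
    <= M * K + M ^+ 2 * (N / 2 * r).
  apply: (@le_trans _ _ (\sum_u \sum_v
    (resistance R e u x + N / 2 * r + resistance R e x v))).
    by do 2!apply: ler_sum => ? _; apply: resistance_flower_le.
  have sum_const (z : R) : \sum_(w : T) z = M * z.
    by rewrite sumr_const -[LHS]mulr_natl.
  under eq_bigr do rewrite big_split /= sum_const.
  rewrite big_split /= sum_const -mulr_sumr big_split /= sum_const.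
  (* The row and column of [x] in the resistance matrix meet only in the zero entry [(x, x)], so
     together they are at most [K]. *)
  suff : \sum_u resistance R e u x + \sum_v resistance R e x v <= K.
    by move/(ler_wpM2l (ler0n R #|T|)); rewrite -/M; lra.
  rewrite /K [in leRHS](bigD1 x) //= addrC lerD2r (bigD1 x) //=.
  rewrite resistancexx // add0r.
  apply: ler_sum => u _; rewrite (bigD1 x) //= lerDl.
  by apply: sumr_ge0 => v _; apply: resistance_ge0.
apply: (@le_trans _ _ (\sum_(i < n)
  (K + (N - 1) * (M * K + M ^+ 2 * (N / 2 * r))))).
  apply: ler_sum => i _; rewrite (bigD1 i) //=; apply: lerD (same i) _.
  apply: le_trans (ler_sum _ (fun j _ => other i j)) _.
  rewrite sumr_const (cardC1 i) card_ord -[leLHS]mulr_natl /N -subn1 natrB //; lia.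
rewrite sumr_const card_ord -[leLHS]mulr_natl -/N; lra.
Qed.

End FlowerResistance.

Theorem theorem3p7 (R : realFieldType) (T : finType) (e : rel T)
    (m n : nat) (x y : T)
    (e_sym : symmetric e) (e_irr : irreflexive e)
    (e_conn : forall u v : T, connect e u v)
    (card_T : #|T| = m) (neq_xy : x != y) (n_ge3 : (3 <= n)%N) :
  let r := resistance R e x y in
  let KfG := kirchhoff_index R e in
  let KfF := kirchhoff_index R (@flower_adj n T x y e) in
  n%:R * KfG - m%:R * (m%:R - 1) * r / 2%:R <= KfF
  /\ KfF <= KfG * (n%:R + n%:R * m%:R * (n%:R - 1))
            + r * (n%:R ^+ 3 - n%:R ^+ 2) * m%:R ^+ 2 / 4%:R.
Proof.
rewrite -card_T /=; split; first exact: kirchhoff_flower_ge.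
exact: kirchhoff_flower_le.
Qed.
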